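(* Let $W_2=\mathrm{Tot}(\mathcal O_{\mathbb P^1}(-2)\oplus\mathcal O_{\mathbb P^1})$ and let $e_1,e_2,e_3,e_4$ be the Poisson structures on $W_2$ specified in the context. The degeneracy loci of these Poisson structures on $W_2$ are: (i) isomorphic to $\mathbb C^2$ for $e_1$; (ii) isomorphic to $\mathbb P^1\times\mathbb C$ for $e_2$; (iii) isomorphic to $\mathbb C^2\cup\mathbb C$ for $e_3$; (iv) empty for $e_4$.
   Context: $W_2$ is obtained by gluing $U=\mathbb C^3_{\{z,u_1,u_2\}}$ and $V=\mathbb C^3_{\{\xi,v_1,v_2\}}$ by $(\xi,v_1,v_2)=(z^{-1},z^2u_1,u_2)$ where $z,\xi\neq0$. Write $\partial_0=\partial/\partial z$, $\partial_1=\partial/\partial u_1$, $\partial_2=\partial/\partial u_2$. The global holomorphic Poisson structures $e_i$ on $W_2$ are given on $U$ by $$e_1=\partial_2\wedge\partial_0,\quad e_2=u_1\,\partial_1\wedge\partial_2,\quad e_3=z\,\partial_2\wedge\partial_0,\quad e_4=\partial_0\wedge\partial_1 .$$ The degeneracy locus of a holomorphic Poisson structure $\sigma$ on a complex threefold is the set of points where $\sigma$, viewed as a map from the cotangent to the tangent bundle by contracting a $1$-form with the bivector field, has rank $0$. *)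

(* Defs.v *)
From HB Require Import structures.
From mathcomp Require Import all_boot all_order all_algebra.
From mathcomp Require Import ring.
From mathcomp Require Import generic_quotient.
From mathcomp Require Import all_classical all_reals all_analysis.

Set Implicit Arguments.
Unset Strict Implicit.
Unset Printing Implicit Defensive.

Import Order.TTheory GRing.Theory Num.Theory.
Import numFieldNormedType.Exports.

Local Open Scope classical_set_scope.
Local Open Scope ring_scope.

(* Complex manifolds are developed over an abstract numFieldType K, because the
   topology of a numFieldType is inferred from the structure; the intended
   instance is K := R[i] with R : realType.  A map between spaces of row
   vectors over R[i] is holomorphic on an open set when it is (R[i]-linearly
   Frechet) [differentiable] at all of its points. *)

(* The topology is the one making all [param i] open embeddings; every chart is
   a whole affine space, which suffices for the manifolds used here, and charts
   may have different dimensions. *)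
Record cmanifold (K : numFieldType) := CManifold {
  mpoint :> Type;
  chart : countType;
  cdim : chart -> nat;
  param : forall i : chart, 'rV[K]_(cdim i) -> mpoint;
  param_inj : forall i, injective (@param i);
  param_surj : forall p : mpoint, exists i x, @param i x = p;
  param_transition : forall i j (x : 'rV[K]_(cdim i)) (y : 'rV[K]_(cdim j)),
    @param i x = @param j y ->
    exists h : 'rV[K]_(cdim i) -> 'rV[K]_(cdim j),
      \forall t \near x, differentiable h t /\ param t = param (h t);
  param_hausdorff : forall i j (x : 'rV[K]_(cdim i)) (y : 'rV[K]_(cdim j)),
    @param i x <> @param j y ->
    exists A B, [/\ nbhs x A, nbhs y B &
      forall s t, A s -> B t -> @param i s <> @param j t] }.

Arguments param {K} c i x.

(* Holomorphy of f : A -> N at p in A, for the reduced complex structure of a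
   subset A of M: near p, f is the restriction of a holomorphic map from M. *)
Definition holomorphic_at (K : numFieldType) (M N : cmanifold K) (A : set M)
    (f : M -> N) (p : M) : Prop :=
  exists i (x : 'rV[K]_(cdim i)) j (h : 'rV[K]_(cdim i) -> 'rV[K]_(cdim j)),
    param M i x = p /\
    \forall t \near x, differentiable h t /\
      (A (param M i t) -> f (param M i t) = param N j (h t)).

Definition biholomorphic (K : numFieldType) (M N : cmanifold K)
    (A : set M) (B : set N) : Prop :=
  exists (f : M -> N) (g : N -> M),
    [/\ forall p, A p -> B (f p) /\ g (f p) = p,
        forall q, B q -> A (g q) /\ f (g q) = q,
        forall p, A p -> holomorphic_at A f p &
        forall q, B q -> holomorphic_at B g q].

(* [biv i x] is the matrix of sigma(dx_a, dx_b) in the chart i, so that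
   contraction with sigma sends the 1-form a (a row of coefficients) to the
   vector a *m biv i x.  The last field is the vanishing of the components of
   the Schouten bracket [sigma, sigma], up to a constant factor. *)
Record poisson_structure (K : numFieldType) (M : cmanifold K) :=
    PoissonStructure {
  biv :> forall i : chart M, 'rV[K]_(cdim i) -> 'M[K]_(cdim i);
  biv_anti : forall i (x : 'rV[K]_(cdim i)), (biv x)^T = - biv x;
  biv_holomorphic : forall i (x : 'rV[K]_(cdim i)), differentiable (@biv i) x;
  biv_glue : forall i j (x : 'rV[K]_(cdim i))
      (h : 'rV[K]_(cdim i) -> 'rV[K]_(cdim j)),
    (\forall t \near x,
      differentiable h t /\ param M i t = param M j (h t)) ->
    biv (h x) = ('J h x)^T *m biv x *m 'J h x;
  biv_jacobi : forall i (x : 'rV[K]_(cdim i)) (a b c : 'I_(cdim i)),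
    let d l a b := 'D_(delta_mx 0 l) (fun y => @biv i y a b) x in
    \sum_l (biv x a l * d l b c + biv x b l * d l c a + biv x c l * d l a b)
    = 0 }.

Arguments biv {K M} p i x.

Definition contract (K : numFieldType) n (s : 'M[K]_n) (a : 'rV[K]_n) :
  'rV[K]_n := a *m s.

Definition degeneracy_locus (K : numFieldType) (M : cmanifold K)
    (s : poisson_structure M) : set M :=
  [set p | exists i x, param M i x = p /\
             \rank (lin1_mx (contract (biv s i x))) = 0%N].

Definition wedge (K : numFieldType) n (v w : 'rV[K]_n) : 'M[K]_n :=
  v^T *m w - w^T *m v.

Section AffineProductSum.
Variable K : numFieldType.

Lemma affine_transition n (x y : 'rV[K]_n) : x = y ->
  exists h : 'rV[K]_n -> 'rV[K]_n,
    \forall t \near x, differentiable h t /\ t = h t.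
Proof. by move=> _; exists id; near=> t; split. Unshelve. all: by end_near. Qed.

Lemma rV_hausdorff n (x y : 'rV[K]_n) : x <> y ->
  exists A B, [/\ nbhs x A, nbhs y B & forall s t, A s -> B t -> s <> t].
Proof.
move=> xy; have := @norm_hausdorff K 'rV[K]_n.
rewrite open_hausdorff => /(_ x y) H.
have [|[A B] /= [xA yB] [oA oB /eqP AB]] := H; first exact/eqP.
exists A, B; split.
- by apply: open_nbhs_nbhs; split=> //; rewrite inE in xA.
- by apply: open_nbhs_nbhs; split=> //; rewrite inE in yB.
- by move=> s t As Bt st; suff : set0 s by []; rewrite -AB; split=> //; rewrite st.
Qed.

Definition affine (n : nat) : cmanifold K :=
  @CManifold K 'rV[K]_n unit (fun=> n) (fun=> id) (fun=> @inj_id _)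
    (fun p => ex_intro _ tt (ex_intro _ p erefl))
    (fun _ _ => @affine_transition n) (fun _ _ => @rV_hausdorff n).

Lemma differentiable_mxP (V : normedModType K) m n (f : V -> 'M[K]_(m, n)) x :
  (forall i j, differentiable (fun y => f y i j : K) x) -> differentiable f x.
Proof.
move=> fx.
have -> : f = (fun y => \sum_(i < m) \sum_(j < n) (f y i j) *: delta_mx i j).
  by apply/funext => y; rewrite -matrix_sum_delta.
have -> : (fun y => \sum_(i < m) \sum_(j < n) f y i j *: delta_mx i j) =
  \sum_(i < m) \sum_(j < n) (fun y => f y i j *: (delta_mx i j : 'M[K]_(m, n))).
  apply/funext => y; rewrite fct_sumE; apply: eq_bigr => i _.
  by rewrite fct_sumE.
apply: differentiable_sum => i; apply: differentiable_sum => j.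
exact: differentiableZl.
Qed.

Lemma differentiable_mxE (V : normedModType K) m n (f : V -> 'M[K]_(m, n)) x
  i j : differentiable f x -> differentiable (fun y => f y i j : K) x.
Proof.
move=> fx; apply: (@differentiable_comp _ _ _ _ f (fun M => M i j)) => //.
exact: differentiable_coord.
Qed.

Lemma differentiable_row_mx (V : normedModType K) m n
    (f : V -> 'rV[K]_m) (g : V -> 'rV[K]_n) x :
  differentiable f x -> differentiable g x ->
  differentiable (fun y => row_mx (f y) (g y)) x.
Proof.
move=> df dg; apply: differentiable_mxP => i j.
rewrite (_ : (fun _ => _) = (fun y => match fintype.split j with
  | inl k => f y i k | inr k => g y i k end)); last first.
  by apply/funext => y; rewrite mxE; case: (fintype.split j).
by case: (fintype.split j) => k; exact: differentiable_mxE.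
Qed.

Lemma lsubmx_cvg m n (x : 'rV[K]_(m + n)) : lsubmx @ x --> lsubmx x.
Proof. exact/differentiable_continuous/differentiable_lsubmx. Qed.

Lemma rsubmx_cvg m n (x : 'rV[K]_(m + n)) : rsubmx @ x --> rsubmx x.
Proof. exact/differentiable_continuous/differentiable_rsubmx. Qed.

Section Prod.
Variables M N : cmanifold K.
Let I : countType := (chart M * chart N)%type.
Let dim (i : I) := (@cdim K M i.1 + @cdim K N i.2)%N.

Definition prod_param (i : I) (x : 'rV[K]_(dim i)) : M * N :=
  (param M i.1 (lsubmx x), param N i.2 (rsubmx x)).

Lemma prod_param_inj i : injective (@prod_param i).
Proof.
move=> x y [/param_inj l /param_inj r].
by rewrite -[x]hsubmxK -[y]hsubmxK l r.
Qed.

Lemma prod_param_surj p : exists i x, @prod_param i x = p.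
Proof.
case: p => p q; have [i [x <-]] := param_surj p; have [j [y <-]] := param_surj q.
by exists (i, j), (row_mx x y); rewrite /prod_param /= row_mxKl row_mxKr.
Qed.

Lemma prod_param_transition i j x y : @prod_param i x = @prod_param j y ->
  exists h : 'rV[K]_(dim i) -> 'rV[K]_(dim j),
    \forall t \near x, differentiable h t /\ prod_param t = prod_param (h t).
Proof.
case=> /param_transition[f Hf] /param_transition[g Hg].
exists (fun t => row_mx (f (lsubmx t)) (g (rsubmx t))).
have {Hf} := lsubmx_cvg Hf; have {Hg} := rsubmx_cvg Hg.
rewrite !near_simpl; apply: filterS2 => t [dg eg] [df ef]; split.
  apply: differentiable_row_mx; apply: differentiable_comp => //.
    exact: differentiable_lsubmx.
  exact: differentiable_rsubmx.
by rewrite /prod_param row_mxKl row_mxKr -ef -eg.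
Qed.

Lemma prod_param_hausdorff i j x y : @prod_param i x <> @prod_param j y ->
  exists A B, [/\ nbhs x A, nbhs y B &
    forall s t, A s -> B t -> @prod_param i s <> @prod_param j t].
Proof.
move=> xy.
have [l|/param_hausdorff[A [B [xA yB AB]]]] :=
  pselect (param M i.1 (lsubmx x) = param M j.1 (lsubmx y)); last first.
  exists (lsubmx @^-1` A), (lsubmx @^-1` B); split; try exact: lsubmx_cvg.
  by move=> s t As Bt [] e _; exact: (AB _ _ As Bt e).
have [r|/param_hausdorff[A [B [xA yB AB]]]] :=
  pselect (param N i.2 (rsubmx x) = param N j.2 (rsubmx y)); last first.
  exists (rsubmx @^-1` A), (rsubmx @^-1` B); split; try exact: rsubmx_cvg.
  by move=> s t As Bt [] _ e; exact: (AB _ _ As Bt e).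
by exfalso; apply: xy; rewrite /prod_param l r.
Qed.

Definition prod_manifold : cmanifold K :=
  CManifold prod_param_inj prod_param_surj prod_param_transition
    prod_param_hausdorff.

End Prod.

Section Sum.
Variables M N : cmanifold K.
Let I : countType := (chart M + chart N)%type.
Let dim (i : I) := match i with inl i => cdim i | inr j => cdim j end.

Definition sum_param (i : I) : 'rV[K]_(dim i) -> M + N :=
  match i return 'rV[K]_(dim i) -> M + N with
  | inl i => fun x => inl (param M i x)
  | inr j => fun x => inr (param N j x)
  end.

Lemma sum_param_inj i : injective (@sum_param i).
Proof. by case: i => i x y [] /param_inj. Qed.

Lemma sum_param_surj p : exists i x, @sum_param i x = p.
Proof.
by case: p => p; have [i [x <-]] := param_surj p; [exists (inl i)|exists (inr i)];
  exists x.
Qed.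

Lemma sum_param_transition i j x y : @sum_param i x = @sum_param j y ->
  exists h : 'rV[K]_(dim i) -> 'rV[K]_(dim j),
    \forall t \near x, differentiable h t /\ sum_param t = sum_param (h t).
Proof.
case: i x => i x; case: j y => j y //= [] /param_transition[h H]; exists h;
  by apply: filterS H => t [dh ->].
Qed.

Lemma sum_param_hausdorff i j x y : @sum_param i x <> @sum_param j y ->
  exists A B, [/\ nbhs x A, nbhs y B &
    forall s t, A s -> B t -> @sum_param i s <> @sum_param j t].
Proof.
case: i x => i x; case: j y => j y //= xy;
  try by exists setT, setT; split=> //; exact: filterT.
all: have [|A [B [xA yB AB]]] := @param_hausdorff _ _ _ _ x y;
  [by move=> e; apply: xy; rewrite e|exists A, B; split=> // s t As Bt [] e;
  exact: (AB _ _ As Bt e)].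
Qed.

(* Disjoint union. *)
Definition sum_manifold : cmanifold K :=
  CManifold sum_param_inj sum_param_surj sum_param_transition
    sum_param_hausdorff.

End Sum.

End AffineProductSum.

(* Two copies of K^(n+1), indexed by bool, glued along x_0 != 0 by an
   involution tau that inverts the coordinate x_0. *)
Section Glue.
Variables (K : numFieldType) (n : nat) (tau : 'rV[K]_n.+1 -> 'rV[K]_n.+1).
Hypothesis tau0 : forall x, tau x 0 0 = (x 0 0)^-1.
Hypothesis tauK : forall x : 'rV[K]_n.+1, x 0 0 != 0 -> tau (tau x) = x.
Hypothesis tau_diff : forall x : 'rV[K]_n.+1, x 0 0 != 0 -> differentiable tau x.

Definition glue_rel (p q : bool * 'rV[K]_n.+1) : bool :=
  if p.1 == q.1 then p.2 == q.2 else (p.2 0 0 != 0) && (q.2 == tau p.2).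

Lemma glue_rel_equiv : equiv_class_of glue_rel.
Proof.
have sym : forall p q, glue_rel p q -> glue_rel q p.
  move=> [b x] [c y]; rewrite /glue_rel /= [c == b]eq_sym; case: eqP => _.
    by rewrite eq_sym.
  by move=> /andP[x0 /eqP->]; rewrite tau0 invr_neq0 //= tauK.
split=> [[b x]|p q|].
- by rewrite /glue_rel /= !eqxx.
- by apply/idP/idP; exact: sym.
move=> [c y] [b x] [d z]; rewrite /glue_rel /=.
case: b; case: c; case: d => //=.
all: try by move=> /eqP->.
all: try by move=> /andP[x0 /eqP->] => /eqP <-; rewrite x0 eqxx.
all: by move=> /andP[x0 /eqP->] /andP[_ /eqP->]; rewrite tauK.
Qed.

Canonical glue_equiv := EquivRelPack glue_rel_equiv.

Definition glue_point := {eq_quot glue_equiv}%qT.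

Definition glue_param (b : bool) (x : 'rV[K]_n.+1) : glue_point :=
  (\pi_glue_point (b, x))%qT.

Lemma glue_paramE b c x y :
  glue_param b x = glue_param c y <-> glue_rel (b, x) (c, y).
Proof.
rewrite /glue_param; split=> [/eqP|H].
  by rewrite eqmodE.
by apply/eqP; rewrite eqmodE.
Qed.

Lemma glue_param_inj b : injective (glue_param b).
Proof. by move=> x y /glue_paramE; rewrite /glue_rel /= eqxx => /eqP. Qed.

Lemma glue_param_surj p : exists b x, glue_param b x = p.
Proof.
exists (repr p).1, (repr p).2.
by rewrite /glue_param -surjective_pairing reprK.
Qed.

Lemma nbhs_coord0 (x : 'rV[K]_n.+1) (A : set K) :
  nbhs (x 0 0) A -> nbhs x [set t : 'rV[K]_n.+1 | A (t 0 0)].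
Proof.
by move=> xA; apply: (@coord_continuous K 1 n.+1 0 0 x).
Qed.

Lemma nbhs_coord0_neq0 (x : 'rV[K]_n.+1) : x 0 0 != 0 ->
  nbhs x [set t : 'rV[K]_n.+1 | t 0 0 != 0].
Proof.
move=> x0; apply: (@nbhs_coord0 x (fun s => s != 0)).
exact: (@cvgr_neq0 K K K (nbhs (x 0 0)) _ id (x 0 0) _ x0).
Qed.

Lemma glue_transition b c (x y : 'rV[K]_n.+1) :
  glue_param b x = glue_param c y ->
  exists h : 'rV[K]_n.+1 -> 'rV[K]_n.+1,
    \forall t \near x, differentiable h t /\ glue_param b t = glue_param c (h t).
Proof.
move=> /glue_paramE; rewrite /glue_rel /=; case: eqVneq => [->|bc] H.
  by exists id; near=> t; split.
move/andP: H => [x0 _]; exists tau.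
apply: filterS (nbhs_coord0_neq0 x0) => t t0; split; first exact: tau_diff.
by apply/glue_paramE; rewrite /glue_rel /= (negbTE bc) t0 eqxx.
Unshelve. all: by end_near.
Qed.

Lemma glue_hausdorff b c (x y : 'rV[K]_n.+1) :
  glue_param b x <> glue_param c y ->
  exists A B, [/\ nbhs x A, nbhs y B &
    forall s t, A s -> B t -> glue_param b s <> glue_param c t].
Proof.
have [->|bc] := eqVneq b c.
  move=> xy; have [|A [B [xA yB AB]]] := @rV_hausdorff K _ x y.
    by move=> e; apply: xy; rewrite e.
  by exists A, B; split=> // s t As Bt /glue_param_inj e; exact: (AB _ _ As Bt e).
move=> xy.
have [x0|x0] := eqVneq (x 0 0) 0; last first.
  have [|A [B [xA yB AB]]] := @rV_hausdorff K _ (tau x) y.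
    move=> e; apply: xy; apply/glue_paramE.
    by rewrite /glue_rel /= (negbTE bc) x0 e eqxx.
  exists (tau @^-1` A), B; split=> //.
    exact: (differentiable_continuous (tau_diff x0)).
  move=> s t As Bt /glue_paramE.
  rewrite /glue_rel /= (negbTE bc) => /andP[_ /eqP ts].
  exact: (AB _ _ As Bt).
have [y0|y0] := eqVneq (y 0 0) 0; last first.
  have [|A [B [yA xB AB]]] := @rV_hausdorff K _ (tau y) x.
    move=> e; apply: xy; apply/esym/glue_paramE.
    by rewrite /glue_rel /= eq_sym (negbTE bc) y0 e eqxx.
  exists B, (tau @^-1` A); split=> //.
    exact: (differentiable_continuous (tau_diff y0)).
  move=> s t Bs At /esym/glue_paramE.
  rewrite /glue_rel /= eq_sym (negbTE bc) => /andP[_ /eqP ts].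
  exact: (AB _ _ At Bs).
have small (u : 'rV[K]_n.+1) : u 0 0 = 0 -> 
    nbhs u [set t : 'rV[K]_n.+1 | `|t 0 0| < 1].
  move=> u0; apply: (@nbhs_coord0 u (fun s => `|s| < 1)).
  rewrite u0; apply/nbhs_ballP; exists 1 => //= s.
  by rewrite /ball /= sub0r normrN.
exists [set s : 'rV[K]_n.+1 | `|s 0 0| < 1],
  [set s : 'rV[K]_n.+1 | `|s 0 0| < 1].
split; try exact: small.
move=> s t s1 t1 /glue_paramE.
rewrite /glue_rel /= (negbTE bc) => /andP[s0 /eqP ts].
move: t1; rewrite /= ts tau0 normfV invf_lt1 ?normr_gt0 // => /(lt_trans s1).
by rewrite ltxx.
Qed.

Definition glue_manifold : cmanifold K :=
  @CManifold K glue_point bool (fun=> n.+1) glue_param glue_param_inj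
    glue_param_surj glue_transition glue_hausdorff.

End Glue.

Section Models.
Variable K : numFieldType.

Definition P1_tau (x : 'rV[K]_1) : 'rV[K]_1 := const_mx (x 0 0)^-1.

Lemma P1_tau0 (x : 'rV[K]_1) : P1_tau x 0 0 = (x 0 0)^-1.
Proof. by rewrite mxE. Qed.

Lemma P1_tauK (x : 'rV[K]_1) : x 0 0 != 0 -> P1_tau (P1_tau x) = x.
Proof.
by move=> _; apply/rowP => i; rewrite ord1 !mxE invrK.
Qed.

Lemma differentiable_coordV n (x : 'rV[K]_n.+1) : x 0 0 != 0 ->
  differentiable (fun t : 'rV[K]_n.+1 => (t 0 0)^-1 : K) x.
Proof.
by move=> x0; apply: differentiableV => //; exact: differentiable_coord.
Qed.

Lemma P1_tau_diff (x : 'rV[K]_1) : x 0 0 != 0 -> differentiable P1_tau x.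
Proof.
move=> x0; apply: differentiable_mxP => i j.
rewrite (_ : (fun _ => _) = (fun t : 'rV[K]_1 => (t 0 0)^-1)).
  exact: differentiable_coordV.
by apply/funext => t; rewrite mxE.
Qed.

(* The two charts are the affine coordinates z and z^-1. *)
Definition P1 : cmanifold K := glue_manifold P1_tau0 P1_tauK P1_tau_diff.

(* (z, u1, u2) |-> (z^-1, z^2 u1, u2) *)
Definition W2_tau (x : 'rV[K]_3) : 'rV[K]_3 :=
  \row_j [:: (x 0 0)^-1; x 0 0 ^+ 2 * x 0 1; x 0 2]`_j.

Lemma W2_tau0 (x : 'rV[K]_3) : W2_tau x 0 0 = (x 0 0)^-1.
Proof. by rewrite mxE. Qed.

Lemma W2_tauK (x : 'rV[K]_3) : x 0 0 != 0 -> W2_tau (W2_tau x) = x.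
Proof.
move=> x0; apply/rowP => -[[|[|[|//]]] Hi]; rewrite !mxE /= ?invrK //.
- by congr (x _ _); apply/val_inj.
- by rewrite mulrA exprVn mulVf ?expf_neq0// mul1r; congr (x _ _); apply/val_inj.
- by congr (x _ _); apply/val_inj.
Qed.

Lemma W2_tau_diff (x : 'rV[K]_3) : x 0 0 != 0 -> differentiable W2_tau x.
Proof.
move=> x0; apply: differentiable_mxP => i j.
rewrite (_ : (fun _ => _) = (fun t : 'rV[K]_3 =>
  [:: (t 0 0)^-1; t 0 0 ^+ 2 * t 0 1; t 0 2]`_j)); last first.
  by apply/funext => t; rewrite mxE.
have dc k : differentiable (fun t : 'rV[K]_3 => t 0 k : K) x.
  exact: differentiable_coord.
case: j => -[|[|[|//]]] Hj /=.
- exact: differentiable_coordV.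
- apply: differentiableM => //.
  exact: (differentiableM (dc 0) (dc 0)).
- exact: dc.
Qed.

Definition W2 : cmanifold K := glue_manifold W2_tau0 W2_tauK W2_tau_diff.

(* The charts with coordinates (z, u1, u2) and (xi, v1, v2). *)
Definition W2_U : chart W2 := false.
Definition W2_V : chart W2 := true.

Definition partial (a : 'I_3) : 'rV[K]_3 := delta_mx 0 a.

Definition e1_U (x : 'rV[K]_3) : 'M[K]_3 := wedge (partial 2) (partial 0).
Definition e2_U (x : 'rV[K]_3) : 'M[K]_3 :=
  x 0 1 *: wedge (partial 1) (partial 2).
Definition e3_U (x : 'rV[K]_3) : 'M[K]_3 :=
  x 0 0 *: wedge (partial 2) (partial 0).
Definition e4_U (x : 'rV[K]_3) : 'M[K]_3 := wedge (partial 0) (partial 1).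

End Models.

(* Each e_i extends to a Poisson structure on W2. *)
Section Existence.
Variable K : numFieldType.

Lemma derive_mxE (V : normedModType K) m n (f : V -> 'M[K]_(m, n)) x v i j :
  differentiable f x -> 'D_v (fun y => f y i j : K) x = ('D_v f x) i j.
Proof.
move=> /(@diff_derivable _ _ _ _ _ v) fx.
apply: cvg_lim; first exact: norm_hausdorff.
rewrite (_ : (fun _ => _) = (fun M : 'M[K]_(m, n) => M i j) \o
  (fun h => h^-1 *: ((f \o shift x) (h *: v) - f x))); last first.
  by apply/funext => h /=; rewrite !mxE.
exact: (cvg_comp _ _ fx (@coord_continuous K m n i j _)).
Qed.

Lemma is_derive_coord n (x v : 'rV[K]_n) k :
  is_derive x v (fun t : 'rV[K]_n => t 0 k : K) (v 0 k).
Proof.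
apply: DeriveDef; first exact/diff_derivable/differentiable_coord.
by rewrite (@derive_mxE _ _ _ id) // derive_id.
Qed.

Lemma jacobianE n m (f : 'rV[K]_n -> 'rV[K]_m) x i j : differentiable f x ->
  'J f x i j = 'D_(delta_mx 0 i) (fun y => f y 0 j : K) x.
Proof.
move=> fx; rewrite derive_mxE // deriveEjacobian // -rowE.
by rewrite [RHS]mxE.
Qed.

Lemma near_jacobian n m (f g : 'rV[K]_n -> 'rV[K]_m) x :
  differentiable f x -> differentiable g x ->
  (\forall t \near x, f t = g t) -> 'J f x = 'J g x.
Proof.
move=> df dg fg; apply/matrixP => i j.
apply: (etrans (jacobianE i j df)); apply/esym/(etrans (jacobianE i j dg)).
by apply: near_eq_derive; apply: filterS fg => t ->.
Qed.

Lemma jacobian_id n (x : 'rV[K]_n) : 'J id x = 1%:M.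
Proof.
apply/matrixP => i j.
apply: (etrans (@jacobianE _ _ id x i j _)) => //.
have D := is_derive_coord x (delta_mx 0 i) j.
by rewrite derive_val !mxE eqxx eq_sym.
Qed.

Definition W2_jac (x : 'rV[K]_3) : 'M[K]_3 := \matrix_(i, j) nth 0 (nth nil
  [:: [:: - (x 0 0) ^- 2; 2 * x 0 0 * x 0 1; 0];
      [:: 0; x 0 0 ^+ 2; 0]; [:: 0; 0; 1]] i) j.

Lemma W2_jacobian (x : 'rV[K]_3) : x 0 0 != 0 -> 'J (@W2_tau K) x = W2_jac x.
Proof.
move=> x0; apply/matrixP => i j; apply: (etrans (jacobianE i j (W2_tau_diff x0))).
rewrite (_ : (fun _ => _) = (fun t : 'rV[K]_3 =>
  [:: (t 0 0)^-1; t 0 0 ^+ 2 * t 0 1; t 0 2]`_j)); last first.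
  by apply/funext => t; rewrite mxE.
have D k := is_derive_coord x (delta_mx 0 i) k.
case: j => -[|[|[|//]]] Hj /=.
- have [D0 E0] := D 0; rewrite deriveV // E0 !mxE {D0 E0}; case: i {D} => -[|[|[|//]]] Hi /=;
    by rewrite ?scaler0 // /GRing.scale /= mulr1.
- have D2 : is_derive x (delta_mx 0 i)
      (fun t : 'rV[K]_3 => t 0 0 ^+ 2 * t 0 1 : K) _ :=
    is_deriveM (is_deriveM (D 0) (D 0)) (D 1).
  rewrite [LHS](@derive_val _ _ _ _ _ _ _ D2) /GRing.scale /=.
  rewrite -[X in X * _]/(x 0 0 * x 0 0).
  by rewrite !mxE /=; case: i {D D2} => -[|[|[|//]]] Hi /=; ring.
- have [_ E2] := D 2; rewrite E2 !mxE {E2}; by case: i {D} => -[|[|[|//]]] Hi.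
Qed.

Lemma W2_jacK (x : 'rV[K]_3) : x 0 0 != 0 -> W2_jac x *m W2_jac (W2_tau x) = 1%:M.
Proof.
move=> x0; apply/matrixP => i j; rewrite !mxE !big_ord_recl big_ord0 !mxE /=.
case: i => -[|[|[|//]]] Hi; case: j => -[|[|[|//]]] Hj /=; by field.
Qed.


Lemma wedge_mul n m (v w : 'rV[K]_n) (J : 'M[K]_(n, m)) :
  J^T *m wedge v w *m J = wedge (v *m J) (w *m J).
Proof. by rewrite /wedge mulmxBr mulmxBl !trmx_mul !mulmxA. Qed.

Lemma wedge_anti n (v w : 'rV[K]_n) : (wedge v w)^T = - wedge v w.
Proof. by rewrite /wedge linearB /= !trmx_mul !trmxK opprB. Qed.

Lemma wedgeE n (v w : 'rV[K]_n) i j :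
  wedge v w i j = v 0 i * w 0 j - w 0 i * v 0 j.
Proof. by rewrite !mxE !big_ord_recl !big_ord0 !mxE !addr0. Qed.

Definition poly_bivector (p q : 'rV[K]_3 -> K) (A B : 'M[K]_3) :=
  fun x => p x *: A + q x *: B.

Lemma poly_bivector_diff p q A B x : differentiable p x ->
  differentiable q x -> differentiable (poly_bivector p q A B) x.
Proof. by move=> dp dq; apply: differentiableD; exact: differentiableZl. Qed.

Lemma poly_bivector_derive p q A B x v i j dp dq :
  is_derive x v p dp -> is_derive x v q dq ->
  'D_v (fun y => poly_bivector p q A B y i j : K) x = dp * A i j + dq * B i j.
Proof.
move=> Dp Dq.
rewrite (_ : (fun _ => _) = (A i j *: p) + (B i j *: q)); last first.
  by apply/funext => y; rewrite /poly_bivector !mxE /GRing.scale /= mulrC [q y * _]mulrC.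
have D := is_deriveD (is_deriveZ (A i j) Dp) (is_deriveZ (B i j) Dq).
by apply: (etrans (@derive_val _ _ _ _ _ _ _ D)); rewrite ![_ *: _]mulrC.
Qed.

Definition W2_poisson_data (SU SV : 'rV[K]_3 -> 'M[K]_3) : forall i : chart (W2 K),
  'rV[K]_(cdim i) -> 'M[K]_(cdim i) :=
  fun i => if i then SV else SU.

Definition jacobi_at (S : 'rV[K]_3 -> 'M[K]_3) x := forall a b c,
  let d l a b := 'D_(delta_mx 0 l) (fun y => S y a b : K) x in
  \sum_l (S x a l * d l b c + S x b l * d l c a + S x c l * d l a b) = 0.

Lemma W2_poisson_exists (SU SV : 'rV[K]_3 -> 'M[K]_3) :
  (forall x, (SU x)^T = - SU x) -> (forall x, (SV x)^T = - SV x) ->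
  (forall x, differentiable SU x) -> (forall x, differentiable SV x) ->
  (forall x, jacobi_at SU x) -> (forall x, jacobi_at SV x) ->
  (forall x : 'rV[K]_3, x 0 0 != 0 ->
    SV (W2_tau x) = (W2_jac x)^T *m SU x *m W2_jac x) ->
  exists s : poisson_structure (W2 K), forall x, biv s (W2_U K) x = SU x.
Proof.
move=> aU aV dU dV jU jV UV.
have VU (x : 'rV[K]_3) : x 0 0 != 0 ->
    SU (W2_tau x) = (W2_jac x)^T *m SV x *m W2_jac x.
  move=> x0; have y0 : W2_tau x 0 0 != 0 by rewrite W2_tau0 invr_eq0.
  have := UV _ y0; rewrite W2_tauK // => ->.
  have E := W2_jacK y0; rewrite W2_tauK // in E.
  rewrite !mulmxA -trmx_mul E trmx1 mul1mx -mulmxA E mulmx1 //.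
unshelve eexists (@PoissonStructure _ (W2 K) (W2_poisson_data SU SV) _ _ _ _).
- by case.
- by case.
- move=> b c x h hx.
  have [dh /glue_paramE] := nbhs_singleton hx.
  case: (eqVneq b c) hx => [<-|bc] hx; rewrite /glue_rel /=.
    rewrite eqxx => /eqP hxx; rewrite -hxx.
    have -> : 'J h x = 1%:M.
      rewrite -(jacobian_id x); apply: near_jacobian => //.
      by apply: filterS hx => t [_ /glue_param_inj].
    by rewrite trmx1 mul1mx mulmx1.
  rewrite (negbTE bc) => /andP[x0 /eqP hxx].
  have -> : 'J h x = W2_jac x.
    apply: etrans (W2_jacobian x0); apply: near_jacobian.
    - exact: dh.
    - exact: W2_tau_diff.
    apply: filterS hx => t [_ /glue_paramE].
    by rewrite /glue_rel /= (negbTE bc) => /andP[_ /eqP].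
  rewrite hxx; move: bc {hx dh hxx}; case: b x h x0; case: c => //= x _ x0 _.
    exact: VU.
  exact: UV.
- by case=> x a b c; [exact: jV|exact: jU].
- by [].
Qed.


Let W a b : 'M[K]_3 := wedge (partial K a) (partial K b).
Local Notation S p q a b c d := (poly_bivector p q (W a b) (W c d)).

Lemma S_anti p q a b c d x : (S p q a b c d x)^T = - S p q a b c d x.
Proof.
by rewrite /poly_bivector linearD !linearZ /= !wedge_anti !scalerN opprD.
Qed.

Lemma wedge_partialE a b i j : W a b i j =
  (i == a)%:R * (j == b)%:R - (i == b)%:R * (j == a)%:R :> K.
Proof. by rewrite wedgeE !mxE !eqxx. Qed.

Lemma jacobi_poly (p q : 'rV[K]_3 -> K) a b c d x (dp dq : 'I_3 -> K) :
  (forall l : 'I_3, is_derive x (delta_mx 0 l) p (dp l)) ->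
  (forall l : 'I_3, is_derive x (delta_mx 0 l) q (dq l)) ->
  (forall i j k : 'I_3,
    let s i j := p x * W a b i j + q x * W c d i j in
    let t l i j := dp l * W a b i j + dq l * W c d i j in
    \sum_l (s i l * t l j k + s j l * t l k i + s k l * t l i j) = 0) ->
  jacobi_at (S p q a b c d) x.
Proof.
move=> Dp Dq H i j k D; rewrite -[RHS](H i j k); apply: eq_bigr => l _.
by rewrite /D !(poly_bivector_derive _ _ _ _ (Dp l) (Dq l)) !mxE.
Qed.

Let coord (k : 'I_3) (x : 'rV[K]_3) : K := x 0 k.

Let Dcoord k x l : is_derive x (delta_mx 0 l) (coord k) (k == l)%:R.
Proof.
have := is_derive_coord x (delta_mx 0 l) k.
by rewrite mxE eqxx.
Qed.

Let dcoord k x : differentiable (coord k) x.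
Proof. exact: differentiable_coord. Qed.

Let dcst (e : K) (x : 'rV[K]_3) : differentiable (cst e) x.
Proof. exact: differentiable_cst. Qed.

Let Dcst (e : K) (x : 'rV[K]_3) (l : 'I_3) : is_derive x (delta_mx 0 l) (cst e) 0.
Proof. exact: is_derive_cst. Qed.

Lemma W2_poisson_poly (p p' q' : 'rV[K]_3 -> K) a b c d
    (dp dp' dq' : 'rV[K]_3 -> 'I_3 -> K) :
  (forall x, differentiable p x) ->
  (forall x, differentiable p' x) -> (forall x, differentiable q' x) ->
  (forall x (l : 'I_3), is_derive x (delta_mx 0 l) p (dp x l)) ->
  (forall x (l : 'I_3), is_derive x (delta_mx 0 l) p' (dp' x l)) ->
  (forall x (l : 'I_3), is_derive x (delta_mx 0 l) q' (dq' x l)) ->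
  (forall x (i j k : 'I_3),
    \sum_l (p x * W a b i l * (dp x l * W a b j k) +
            p x * W a b j l * (dp x l * W a b k i) +
            p x * W a b k l * (dp x l * W a b i j)) = 0) ->
  (forall x (i j k : 'I_3),
    \sum_l ((p' x * W a b i l + q' x * W c d i l) *
              (dp' x l * W a b j k + dq' x l * W c d j k) +
            (p' x * W a b j l + q' x * W c d j l) *
              (dp' x l * W a b k i + dq' x l * W c d k i) +
            (p' x * W a b k l + q' x * W c d k l) *
              (dp' x l * W a b i j + dq' x l * W c d i j)) = 0) ->
  (forall (x : 'rV[K]_3) (i j : 'I_3), x 0 0 != 0 ->
    p' (W2_tau x) * W a b i j + q' (W2_tau x) * W c d i j =
    p x * (W2_jac x a i * W2_jac x b j - W2_jac x b i * W2_jac x a j)) ->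
  exists s : poisson_structure (W2 K),
    forall x, biv s (W2_U K) x = p x *: wedge (partial K a) (partial K b).
Proof.
move=> Cp Cp' Cq' Dp Dp' Dq' jU jV UV.
have SUE x : S p (cst 0) a b a b x = p x *: W a b.
  by rewrite /poly_bivector scale0r addr0.
have JU x : jacobi_at (S p (cst 0) a b a b) x.
  apply: (jacobi_poly (Dp x) (Dcst 0 x)) => i j k.
  apply: etrans (jU x i j k); apply: eq_bigr => l _ /=.
  by rewrite !mul0r !addr0.
have JV x : jacobi_at (S p' q' a b c d) x.
  by apply: (jacobi_poly (Dp' x) (Dq' x)) => i j k; exact: jV.
have [|s Es] := W2_poisson_exists
  (@S_anti p (cst 0) a b a b) (@S_anti p' q' a b c d)
  (fun x => poly_bivector_diff (W a b) (W a b) (Cp x) (dcst 0 x))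
  (fun x => poly_bivector_diff (W a b) (W c d) (Cp' x) (Cq' x)) JU JV.
  move=> x x0; apply/matrixP => i j.
  rewrite SUE -scalemxAr -scalemxAl wedge_mul -!rowE.
  have rE c' k : row c' (W2_jac x) 0 k = W2_jac x c' k by rewrite [LHS]mxE.
  rewrite [RHS]mxE wedgeE !rE; apply: etrans (UV x i j x0).
  by rewrite [LHS]mxE; congr (_ + _); rewrite [LHS]mxE.
by exists s => x; apply: etrans (Es x) (SUE x).
Qed.

Ltac solve_jacobi :=
  let x := fresh in let i := fresh in let j := fresh in let k := fresh in
  intros x i j k;
  rewrite !big_ord_recl big_ord0 !wedge_partialE /coord;
  destruct i as [[|[|[|?]]] ?]; try discriminate;
  destruct j as [[|[|[|?]]] ?]; try discriminate;
  destruct k as [[|[|[|?]]] ?]; try discriminate;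
  rewrite /GRing.scale /=; ring.

Ltac solve_glue :=
  move=> ? [[|[|[|//]]] ?] [[|[|[|//]]] ?] ?;
  rewrite /coord !wedge_partialE !mxE /=; by field.

Lemma e1_exists :
  exists s : poisson_structure (W2 K), forall x, biv s (W2_U K) x = e1_U x.
Proof.
have [|||s Es] := @W2_poisson_poly (fun=> 1)
  (fun y => - (y 0 0 * y 0 0)) (fun y => 2 * (y 0 0 * y 0 1)) 2 0 2 1 _ _ _
  (dcst 1)
  (fun x => differentiableN (differentiableM (dcoord 0 x) (dcoord 0 x)))
  (fun x => differentiableZ 2 (differentiableM (dcoord 0 x) (dcoord 1 x)))
  (Dcst 1)
  (fun x l => is_deriveN (is_deriveM (Dcoord 0 x l) (Dcoord 0 x l)))
  (fun x l => is_deriveZ 2 (is_deriveM (Dcoord 0 x l) (Dcoord 1 x l))).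
- solve_jacobi.
- solve_jacobi.
- solve_glue.
- by exists s => x; rewrite Es scale1r.
Qed.

Lemma e2_exists :
  exists s : poisson_structure (W2 K), forall x, biv s (W2_U K) x = e2_U x.
Proof.
apply: (@W2_poisson_poly (coord 1) (coord 1) (cst 0) 1 2 0 0 _ _ _
  (dcoord 1) (dcoord 1) (dcst 0) (Dcoord 1) (Dcoord 1) (Dcst 0)).
- solve_jacobi.
- solve_jacobi.
- solve_glue.
Qed.

Lemma e3_exists :
  exists s : poisson_structure (W2 K), forall x, biv s (W2_U K) x = e3_U x.
Proof.
apply: (@W2_poisson_poly (coord 0)
  (fun y => - y 0 0) (fun y => 2 * y 0 1) 2 0 2 1 _ _ _
  (dcoord 0) (fun x => differentiableN (dcoord 0 x))
  (fun x => differentiableZ 2 (dcoord 1 x)) (Dcoord 0)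
  (fun x l => is_deriveN (Dcoord 0 x l))
  (fun x l => is_deriveZ 2 (Dcoord 1 x l))).
- solve_jacobi.
- solve_jacobi.
- solve_glue.
Qed.

Lemma e4_exists :
  exists s : poisson_structure (W2 K), forall x, biv s (W2_U K) x = e4_U x.
Proof.
have [|||s Es] := @W2_poisson_poly (fun=> 1) (fun=> -1) (fun=> 0) 0 1 0 0 _ _ _
  (dcst 1) (dcst (-1)) (dcst 0) (Dcst 1) (Dcst (-1)) (Dcst 0).
- solve_jacobi.
- solve_jacobi.
- solve_glue.
- by exists s => x; rewrite Es scale1r.
Qed.

End Existence.

(* Main.v *)
Require Import Defs.
From mathcomp Require Import all_boot all_order all_algebra.
From mathcomp Require Import ring generic_quotient.
From mathcomp Require Import complex.
From mathcomp Require Import all_classical all_reals all_analysis.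

Local Open Scope classical_set_scope.
Local Open Scope ring_scope.

Import GRing.Theory Num.Theory.
Import numFieldNormedType.Exports.

(** Contraction of a 1-form with a bivector has rank 0 exactly when the matrix
    of the bivector is zero ([degeneracyE]), so a degeneracy locus is the common
    zero set, chart by chart, of the components of the bivector.

    The four structures are prescribed on the chart U only.  On the overlap the
    gluing law turns that prescription into one on the points of V with
    xi <> 0; these are dense in V, so continuity leaves a single candidate on all
    of V ([W2_V_unique]).  Since d/dz = - xi^2 d/dxi + 2 xi v1 d/dv1 and
    d/du1 = xi^-2 d/dv1 there, writing d0, d1, d2 for the coordinate fields of V
    the structures become
      e1 : - xi^2 d2/\d0 - 2 xi v1 d1/\d2,    e2 : v1 d1/\d2,
      e3 : - xi d2/\d0 - 2 v1 d1/\d2,         e4 : - d0/\d1.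

    Reading off the zeros:
    - e1 does not vanish on U and vanishes on V along the plane xi = 0;
    - e2 vanishes along u1 = 0 and v1 = 0, which together form the zero section
      of O(-2), a copy of P^1 x C;
    - e3 vanishes on U along the plane z = 0 and on V along the line
      xi = v1 = 0; the plane misses V and the line misses U, so the union is
      disjoint;
    - e4 vanishes nowhere.

    The isomorphisms are the evident coordinate maps.  For e2 the maps are
    defined chart by chart and descend to the glued spaces by [glue_lift].  In
    suitable charts every one of them is the restriction of a linear map, hence
    holomorphic. *)

(** * Degeneracy loci and holomorphic maps in charts *)

(** The locus only asks for some chart where the bivector vanishes; the
    transition law makes the choice of chart irrelevant. *)
Lemma degeneracyE (K : numFieldType) (M : cmanifold K)
    (s : poisson_structure M) (i : chart M) (x : 'rV[K]_(cdim i)) :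
  degeneracy_locus s (param M i x) <-> biv s i x = 0.
Proof.
have rank0 j (y : 'rV[K]_(cdim j)) :
    \rank (lin1_mx (Defs.contract (biv s j y))) = 0%N <-> biv s j y = 0.
  have -> : lin1_mx (Defs.contract (biv s j y)) = biv s j y.
    by apply/matrixP => a b; rewrite mxE /Defs.contract -rowE mxE.
  by split=> [/eqP|->]; [rewrite mxrank_eq0 => /eqP|rewrite mxrank0].
split; last by exists i, x; split=> //; apply/rank0.
move=> [j [y [yx /rank0 sy]]].
have [h H] := param_transition yx.
have [_ hy] := nbhs_singleton H.
have -> : x = h y by apply: (@param_inj _ M i); rewrite -yx.
by rewrite (biv_glue s H) sy mulmx0 mul0mx.
Qed.

Lemma holomorphic_atI (K : numFieldType) (M N : cmanifold K) (A : set M)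
    (f : M -> N) (i : chart M) (j : chart N)
    (h : 'rV[K]_(cdim i) -> 'rV[K]_(cdim j)) :
  (forall t, differentiable h t) ->
  (forall t, A (param M i t) -> f (param M i t) = param N j (h t)) ->
  forall x, holomorphic_at A f (param M i x).
Proof.
move=> dh fh x; exists i, x, j, h; split=> //.
near=> t.
split; [exact: dh|exact: fh].
Unshelve. all: by end_near. Qed.

Lemma differentiable_row_nth (K : numFieldType) (V : normedModType K) n
    (s : V -> seq K) x :
  (forall j : 'I_n, differentiable (fun y => (s y)`_j) x) ->
  differentiable (fun y => \row_(j < n) (s y)`_j : 'rV[K]_n) x.
Proof.
move=> ds; apply: differentiable_mxP => i j.
rewrite (_ : (fun _ => _) = (fun y => (s y)`_j)) //.
by apply/funext => y; rewrite mxE.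
Qed.

(** The complement of the hyperplane x_0 = 0 is dense: a point of the hyperplane
    is approached along the x_0-axis, by nonzero multiples of the first basis
    vector. *)
Lemma eq_off_coord0 (K : numFieldType) (n : nat) (W : normedModType K)
    (f g : 'rV[K]_n.+1 -> W) :
  continuous f -> continuous g ->
  (forall x : 'rV[K]_n.+1, x 0 0 != 0 -> f x = g x) -> f =1 g.
Proof.
move=> cf cg fg x.
have [x0|] := eqVneq (x 0 0) 0; last exact: fg.
pose l (t : K) := x + t *: (delta_mx 0 0 : 'rV[K]_n.+1).
have lx : l t @[t --> 0^'] --> x.
  have -> : x = x + 0 *: (delta_mx 0 0 : 'rV[K]_n.+1) by rewrite scale0r addr0.
  apply: cvgD; first exact: cvg_cst.
  by apply: cvgZr_tmp; exact: nbhs_dnbhs.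
have fl : f \o l @ 0^' --> f x by exact: (cvg_comp _ _ lx (cf x)).
have gl : g \o l @ 0^' --> g x by exact: (cvg_comp _ _ lx (cg x)).
apply: (cvg_unique (@norm_hausdorff K W) fl).
apply: cvg_trans gl; apply: near_eq_cvg.
near=> t; rewrite /= fg // /l !mxE x0 add0r eqxx mulr1.
by near: t; exact: nbhs_dnbhs_neq.
Unshelve. all: by end_near. Qed.

(** * Bivectors on the two charts of W2 *)

Lemma W2_paramE (K : numFieldType) (b c : bool) (x y : 'rV[K]_3) : b != c ->
  param (W2 K) b x = param (W2 K) c y <-> x 0 0 != 0 /\ y = W2_tau x.
Proof.
move=> bc; split=> [/glue_paramE|[x0 ->]].
  by rewrite /glue_rel /= (negbTE bc) => /andP[x0 /eqP].
by apply/glue_paramE; rewrite /glue_rel /= (negbTE bc) x0 eqxx.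
Qed.

(** The gluing law determines the structure on V where xi <> 0, and continuity
    extends the equality to xi = 0, where the points outside U lie. *)
Lemma W2_V_unique (K : numFieldType) (s : poisson_structure (W2 K))
    (SU SV : 'rV[K]_3 -> 'M[K]_3) :
  (forall x, biv s (W2_U K) x = SU x) -> (forall x, differentiable SV x) ->
  (forall x : 'rV[K]_3, x 0 0 != 0 ->
    SV (W2_tau x) = (W2_jac x)^T *m SU x *m W2_jac x) ->
  forall y, biv s (W2_V K) y = SV y.
Proof.
move=> sU dV UV; apply: eq_off_coord0.
- move=> y; apply: differentiable_continuous.
  exact: (@biv_holomorphic _ _ s (W2_V K) y).
- by move=> y; exact: differentiable_continuous.
move=> y y0; rewrite -[y]W2_tauK //; set x := W2_tau y.
have x0 : x 0 0 != 0 by rewrite W2_tau0 invr_neq0.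
rewrite UV // -sU -(W2_jacobian x0).
apply: (@biv_glue _ _ s (W2_U K) (W2_V K) x (@W2_tau K)).
apply: filterS (nbhs_coord0_neq0 x0) => t t0; split; first exact: W2_tau_diff.
exact/W2_paramE.
Qed.

Section Bivectors.
Variable K : numFieldType.
Implicit Types (s : poisson_structure (W2 K)) (x : 'rV[K]_3).

Definition coord (k : 'I_3) x : K := x 0 k.

(** With the basis 2-vectors in cyclic order, each e_i is on U a single
    nonnegated term. *)
Definition bivector3 (a b c : 'rV[K]_3 -> K) x : 'M[K]_3 :=
  a x *: wedge (partial K 0) (partial K 1) +
  b x *: wedge (partial K 1) (partial K 2) +
  c x *: wedge (partial K 2) (partial K 0).

Let scalemxE (k : K) (A : 'M[K]_3) i j : (k *: A) i j = k * A i j.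
Proof. by rewrite mxE. Qed.

Let addmxE (A B : 'M[K]_3) i j : (A + B) i j = A i j + B i j.
Proof. by rewrite mxE. Qed.

Lemma bivector3E a b c x i j : bivector3 a b c x i j =
  a x * ((i == 0)%:R * (j == 1)%:R - (i == 1)%:R * (j == 0)%:R) +
  b x * ((i == 1)%:R * (j == 2)%:R - (i == 2)%:R * (j == 1)%:R) +
  c x * ((i == 2)%:R * (j == 0)%:R - (i == 0)%:R * (j == 2)%:R).
Proof.
by rewrite /bivector3 !addmxE !scalemxE !wedge_partialE.
Qed.

Lemma bivector3_eq0 a b c x :
  bivector3 a b c x = 0 <-> [/\ a x = 0, b x = 0 & c x = 0].
Proof.
split=> [/matrixP B|[a0 b0 c0]].
  have := (B 0 1, B 1 2, B 2 0); rewrite !bivector3E !mxE /=.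
  by rewrite !(mulr0, mulr1, mul1r, oppr0, mul0r, subr0, sub0r, addr0, add0r) => -[[]].
by rewrite /bivector3 a0 b0 c0 !scale0r !addr0.
Qed.

(** Any bivector field a', b', c' on V that glues with the given one on U must be
    the expression of the structure on V, so both parts of the locus can be read
    off the coefficients. *)
Lemma degeneracy_W2 s a b c a' b' c' :
  (forall x, biv s (W2_U K) x = bivector3 a b c x) ->
  (forall x, differentiable a' x) -> (forall x, differentiable b' x) ->
  (forall x, differentiable c' x) ->
  (forall x, x 0 0 != 0 -> bivector3 a' b' c' (W2_tau x) =
    (W2_jac x)^T *m bivector3 a b c x *m W2_jac x) ->
  (forall x, degeneracy_locus s (param (W2 K) (W2_U K) x) <->
    [/\ a x = 0, b x = 0 & c x = 0]) /\
  (forall y, degeneracy_locus s (param (W2 K) (W2_V K) y) <->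
    [/\ a' y = 0, b' y = 0 & c' y = 0]).
Proof.
move=> sU da db dc UV; split=> x; rewrite -bivector3_eq0.
  by rewrite -sU; exact: degeneracyE.
apply: (iff_trans (degeneracyE _ _ _ _ _)).
suff -> : biv s (W2_V K) x = bivector3 a' b' c' x by [].
apply: (W2_V_unique _ _ _ _ sU) => // {}x.
by apply: differentiableD; [apply: differentiableD|]; exact: differentiableZl.
Qed.

Let dcst (k : K) x : differentiable (cst k) x.
Proof. exact: differentiable_cst. Qed.

Let dcoord k x : differentiable (coord k) x.
Proof. exact: differentiable_coord. Qed.

(** The coefficients of the pushforward are the 2x2 minors of the Jacobian; in
    this form the gluing of each e_i is an identity of rational functions. *)
Lemma bivector3_pushE a b c x (J : 'M[K]_3) i j :
  (J^T *m bivector3 a b c x *m J) i j =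
  a x * (J 0 i * J 1 j - J 1 i * J 0 j) +
  b x * (J 1 i * J 2 j - J 2 i * J 1 j) +
  c x * (J 2 i * J 0 j - J 0 i * J 2 j).
Proof.
have rE k l : row k J 0 l = J k l by rewrite mxE.
rewrite /bivector3 !mulmxDr !mulmxDl -!scalemxAr -!scalemxAl !wedge_mul -!rowE.
by rewrite !addmxE !scalemxE !wedgeE !rE.
Qed.

(** Nine scalar identities, one for each entry of the 3x3 matrices. *)
Ltac solve_gluing :=
  move=> ? ?; apply/matrixP => -[[|[|[|//]]] ?] [[|[|[|//]]] ?];
  rewrite bivector3E bivector3_pushE /coord !mxE /=; by field.

Lemma degeneracy_e1 s : (forall x, biv s (W2_U K) x = e1_U x) ->
  (forall x, ~ degeneracy_locus s (param (W2 K) (W2_U K) x)) /\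
  (forall y, degeneracy_locus s (param (W2 K) (W2_V K) y) <-> y 0 0 = 0).
Proof.
move=> e1; have [||U V] := degeneracy_W2 s (cst 0) (cst 0) (cst 1)
    (cst 0) (fun y => -2 * (y 0 0 * y 0 1)) (fun y => - (y 0 0 * y 0 0)) _ (dcst 0)
    (fun x => differentiableZ _ (differentiableM (dcoord 0 x) (dcoord 1 x)))
    (fun x => differentiableN (differentiableM (dcoord 0 x) (dcoord 0 x))).
- by move=> x; rewrite e1 /bivector3 !scale0r !add0r scale1r.
- by solve_gluing.
split=> [x /U[_ _ /eqP]|y]; first by rewrite oner_eq0.
apply: (iff_trans (V y)); split=> [[_ _ /eqP]|y0].
  by rewrite oppr_eq0 mulf_eq0 orbb => /eqP.
by rewrite y0 !mul0r mulr0 oppr0.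
Qed.

Lemma degeneracy_e2 s : (forall x, biv s (W2_U K) x = e2_U x) ->
  forall b x, degeneracy_locus s (param (W2 K) b x) <-> x 0 1 = 0.
Proof.
move=> e2; have [||U V] := degeneracy_W2 s (cst 0) (coord 1) (cst 0)
    (cst 0) (coord 1) (cst 0) _ (dcst 0) (dcoord 1) (dcst 0).
- by move=> x; rewrite e2 /bivector3 !scale0r add0r addr0.
- by solve_gluing.
by case=> x; [apply: (iff_trans (V x))|apply: (iff_trans (U x))]; split=> [[]|].
Qed.

Lemma degeneracy_e3 s : (forall x, biv s (W2_U K) x = e3_U x) ->
  (forall x, degeneracy_locus s (param (W2 K) (W2_U K) x) <-> x 0 0 = 0) /\
  (forall y, degeneracy_locus s (param (W2 K) (W2_V K) y) <->
    y 0 0 = 0 /\ y 0 1 = 0).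
Proof.
move=> e3; have [||U V] := degeneracy_W2 s (cst 0) (cst 0) (coord 0)
    (cst 0) (fun y => -2 * y 0 1) (fun y => - y 0 0) _ (dcst 0)
    (fun x => differentiableZ _ (dcoord 1 x))
    (fun x => differentiableN (dcoord 0 x)).
- by move=> x; rewrite e3 /bivector3 !scale0r !add0r.
- by solve_gluing.
split=> [x|y]; first by apply: (iff_trans (U x)); split=> [[]|].
apply: (iff_trans (V y)); split=> [[_ /eqP + /eqP]|[y0 y1]].
  by rewrite mulf_eq0 oppr_eq0 pnatr_eq0 oppr_eq0 /= => /eqP ? /eqP.
by rewrite y0 y1 mulr0 oppr0.
Qed.

Lemma degeneracy_e4 s : (forall x, biv s (W2_U K) x = e4_U x) ->
  degeneracy_locus s = set0.
Proof.
move=> e4; have [||U V] := degeneracy_W2 s (cst 1) (cst 0) (cst 0)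
    (cst (-1)) (cst 0) (cst 0) _ (dcst (-1)) (dcst 0) (dcst 0).
- by move=> x; rewrite e4 /bivector3 !scale0r !addr0 scale1r.
- by solve_gluing.
rewrite -subset0 => p; have [b [x <-]] := param_surj p.
case: b x => x; [move/V|move/U] => -[/eqP + _ _] /=.
  by rewrite oppr_eq0 oner_eq0.
by rewrite oner_eq0.
Qed.
End Bivectors.

(** * Coordinates and maps on glued spaces *)

(** The inverse of a parametrisation, extended by 0 outside the chart because a
    biholomorphism between subsets is given by maps of the whole manifolds. *)
Definition chart_coord (K : numFieldType) (M : cmanifold K) (i : chart M)
    (p : M) : 'rV[K]_(cdim i) :=
  xget 0 [set x | param M i x = p].

Lemma paramK (K : numFieldType) (M : cmanifold K) (i : chart M) :
  cancel (param M i) (chart_coord K M i).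
Proof.
by move=> x; apply: xget_unique => // y; exact: param_inj.
Qed.

(** The universal property of the gluing: a function out of the glued space is a
    pair of functions on the charts that agree under tau. *)
Lemma glue_lift (K : numFieldType) (n : nat)
    (tau : 'rV[K]_n.+1 -> 'rV[K]_n.+1)
    (tau0 : forall x, tau x 0 0 = (x 0 0)^-1)
    (tauK : forall x : 'rV[K]_n.+1, x 0 0 != 0 -> tau (tau x) = x)
    (tau_diff : forall x : 'rV[K]_n.+1, x 0 0 != 0 -> differentiable tau x)
    (T : Type) (F : bool -> 'rV[K]_n.+1 -> T) :
  (forall b (x : 'rV[K]_n.+1), x 0 0 != 0 -> F (~~ b) (tau x) = F b x) ->
  exists f : glue_manifold tau0 tauK tau_diff -> T,
    forall b (x : 'rV[K]_n.+1),
      f (param (glue_manifold tau0 tauK tau_diff) b x) = F b x.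
Proof.
move=> Ftau; exists (fun p => F (repr p).1 (repr p).2) => b x.
move: (reprK (param (glue_manifold tau0 tauK tau_diff) b x)).
case: repr => c y /glue_paramE; rewrite /glue_rel /=.
have [->|cb] := eqVneq c b => [/eqP->//|/andP[y0 /eqP->]].
by rewrite -(Ftau c) //; case: c b cb => -[].
Qed.

(** * The degeneracy loci *)

Section Loci.
Variable K : numFieldType.
Implicit Types (s : poisson_structure (W2 K)).

Let dcst m (c : K) (x : 'rV[K]_m) : differentiable (fun=> c) x.
Proof. exact: differentiable_cst. Qed.

Let dcoord n k (x : 'rV[K]_n) : differentiable (fun y : 'rV[K]_n => y 0 k : K) x.
Proof. exact: differentiable_coord. Qed.

Definition drop0_row (x : 'rV[K]_3) : 'rV[K]_2 := \row_j [:: x 0 1; x 0 2]`_j.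
Definition cons0_row (x : 'rV[K]_2) : 'rV[K]_3 := \row_j [:: 0; x 0 0; x 0 1]`_j.

Lemma differentiable_drop0 x : differentiable drop0_row x.
Proof.
by apply: differentiable_row_nth => -[[|[|//]] ?]; exact: dcoord.
Qed.

Lemma differentiable_cons0 x : differentiable cons0_row x.
Proof.
by apply: differentiable_row_nth => -[[|[|[|//]]] ?] /=;
  [exact: dcst|exact: dcoord|exact: dcoord].
Qed.

Lemma cons0K x : drop0_row (cons0_row x) = x.
Proof.
by apply/rowP => -[[|[|//]] ?]; rewrite !mxE /=; congr (x _ _); exact: val_inj.
Qed.

Lemma drop0K (x : 'rV[K]_3) : x 0 0 = 0 -> cons0_row (drop0_row x) = x.
Proof.
move=> x0; apply/rowP => -[[|[|[|//]]] ?]; rewrite !mxE /= -?x0;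
  by congr (x _ _); exact: val_inj.
Qed.

(** The locus lies in the single chart V, where it is a coordinate plane. *)
Lemma locus_e1 s : (forall x, biv s (W2_U K) x = e1_U x) ->
  biholomorphic (degeneracy_locus s) [set: affine K 2].
Proof.
move=> /degeneracy_e1[U V].
exists (fun p => drop0_row (chart_coord K (W2 K) (W2_V K) p)),
  (fun q => param (W2 K) (W2_V K) (cons0_row q)); split=> [p|q _|p|q _].
- have [[] [x <-]] := param_surj p; last by move/U.
  by move=> /V x0; split=> //; rewrite paramK drop0K.
- by rewrite paramK cons0K; split=> //; apply/V; rewrite mxE.
- have [[] [x <-]] := param_surj p => H; last by case: (U x H).
  apply: (@holomorphic_atI K (W2 K) (affine K 2) _ _ (W2_V K) tt drop0_row) => t.
    exact: differentiable_drop0.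
  by rewrite paramK.
- apply: (@holomorphic_atI K (affine K 2) (W2 K) _ _ tt (W2_V K) cons0_row) => // t.
  exact: differentiable_cons0.
Qed.

Definition base_coord (x : 'rV[K]_3) : 'rV[K]_1 := \row_j [:: x 0 0]`_j.

(** The coordinate u2 = v2 on the trivial summand. *)
Definition trivial_coord (x : 'rV[K]_3) : 'rV[K]_1 := \row_j [:: x 0 2]`_j.

(** The zero section of O(-2), over P^1 x C: the same formula in both charts,
    because multiplication by z^2 fixes the middle coordinate 0. *)
Definition zero_section (z w : 'rV[K]_1) : 'rV[K]_3 :=
  \row_j [:: z 0 0; 0; w 0 0]`_j.

(** The bundle projection W2 -> P^1 x C and the zero section are both global, so
    they restrict to mutually inverse maps between the locus and the base. *)
Lemma locus_e2 s : (forall x, biv s (W2_U K) x = e2_U x) ->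
  biholomorphic (degeneracy_locus s)
    [set: prod_manifold (P1 K) (affine K 1)].
Proof.
move=> /degeneracy_e2 L.
(* the projection to P^1 x C *)
have [|f fE] := @glue_lift K 2 (@W2_tau K) (@W2_tau0 K) (@W2_tauK K)
  (@W2_tau_diff K) (P1 K * affine K 1)%type
  (fun b x => (param (P1 K) b (base_coord x), trivial_coord x)).
  move=> b x x0; rewrite /trivial_coord !mxE /=; congr (_, _).
  apply/esym/glue_paramE; rewrite /glue_rel /= !mxE x0 /=.
  case: b => /=; apply/eqP/rowP => j; rewrite !mxE ord1 //.
(* the zero section, as a family over P^1 of maps from C *)
have [|g gE] := @glue_lift K 0 (@P1_tau K) (@P1_tau0 K) (@P1_tauK K)
  (@P1_tau_diff K) (affine K 1 -> W2 K)
  (fun b z w => param (W2 K) b (zero_section z w)).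
  move=> b z z0; apply/funext => w; apply/esym/W2_paramE; first by case: b.
  split; first by rewrite mxE.
  by apply/rowP => -[[|[|[|//]]] ?]; rewrite !mxE /= ?mulr0.
exists f, (fun q => g q.1 q.2); split=> [p|[q w] _|p _|[q w] _].
- have [b [x <-]] := param_surj p => /L x1; split=> //.
  rewrite fE gE; congr (param _ _ _); apply/rowP => -[[|[|[|//]]] ?];
  by rewrite !mxE /= -?x1; congr (x _ _); exact: val_inj.
- have [b [z <-]] := param_surj q; rewrite gE; split; first by apply/L; rewrite mxE.
  by rewrite fE; congr (param _ _ _, _); apply/rowP => j; rewrite !mxE ord1.
- have [b [x <-]] := param_surj p.
  apply: (@holomorphic_atI K (W2 K) (prod_manifold (P1 K) (affine K 1)) _ _ b (b, tt)
    (fun t => row_mx (base_coord t) (trivial_coord t))) => t.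
    by apply: differentiable_row_mx; apply: differentiable_row_nth => -[[|//] ?];
      exact: dcoord.
  by rewrite fE /= /prod_param /= row_mxKl row_mxKr.
- have [b [z <-]] := param_surj q.
  rewrite (_ : (_, w) = param (prod_manifold (P1 K) (affine K 1)) (b, tt)
    (row_mx z w)); last by rewrite /= /prod_param /= row_mxKl row_mxKr.
  apply: (@holomorphic_atI K (prod_manifold (P1 K) (affine K 1)) (W2 K) _ _
    (b, tt) b (fun t : 'rV_(1 + 1) => zero_section (lsubmx t) (rsubmx t))) => t.
    apply: differentiable_row_nth => -[[|[|[|//]]] ?] /=; [|exact: dcst|].
      exact: differentiable_mxE (differentiable_lsubmx _).
    exact: differentiable_mxE (differentiable_rsubmx _).
  by rewrite /= gE.
Qed.

(** Hence the two components of the locus of e3 are disjoint. *)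
Lemma W2_U_V (x y : 'rV[K]_3) : y 0 0 = 0 ->
  param (W2 K) (W2_U K) x <> param (W2 K) (W2_V K) y.
Proof.
move=> y0 /W2_paramE[] // x0 yx; move: x0.
by rewrite -invr_eq0 -W2_tau0 -yx y0 eqxx.
Qed.

Definition axis (w : 'rV[K]_1) : 'rV[K]_3 := zero_section 0 w.

(** The map to the disjoint union is (u1, u2) on U and v2 on the rest, hence
    discontinuous on W2.  Its restriction to the locus is nevertheless
    holomorphic: the locus meets V only in the line, where the map is v2. *)
Lemma locus_e3 s : (forall x, biv s (W2_U K) x = e3_U x) ->
  biholomorphic (degeneracy_locus s)
    [set: sum_manifold (affine K 2) (affine K 1)].
Proof.
move=> /degeneracy_e3[U V].
pose f (p : W2 K) : sum_manifold (affine K 2) (affine K 1) :=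
  if `[< exists x, param (W2 K) (W2_U K) x = p >]
  then inl (drop0_row (chart_coord K (W2 K) (W2_U K) p))
  else inr (trivial_coord (chart_coord K (W2 K) (W2_V K) p)).
have fU x : f (param (W2 K) (W2_U K) x) = inl (drop0_row x).
  by rewrite /f asboolT; [rewrite paramK|exists x].
have fV (y : 'rV[K]_3) : y 0 0 = 0 ->
    f (param (W2 K) (W2_V K) y) = inr (trivial_coord y).
  by move=> y0; rewrite /f asboolF ?paramK // => -[x]; exact: W2_U_V.
exists f, (fun q => match q with
  | inl q => param (W2 K) (W2_U K) (cons0_row q)
  | inr w => param (W2 K) (W2_V K) (axis w) end).
have ploc q : degeneracy_locus s (param (W2 K) (W2_U K) (cons0_row q)).
  by apply/U; rewrite mxE.
split=> [p|[q|w] _|p|[q|w] _].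
- have [[] [x <-]] := param_surj p.
    move=> /V[x0 x1]; rewrite fV //; split=> //; congr (param _ _ _).
    apply/rowP => -[[|[|[|//]]] ?]; rewrite !mxE /=.
    + by rewrite -x0; congr (x _ _); exact: val_inj.
    + by rewrite -x1; congr (x _ _); exact: val_inj.
    + by congr (x _ _); exact: val_inj.
  by move=> /U x0; rewrite fU drop0K.
- by rewrite fU cons0K; split.
- split; first by apply/V; rewrite !mxE.
  rewrite fV ?mxE //; congr inr.
  by apply/rowP => j; rewrite !mxE ord1.
- have [[] [x <-]] := param_surj p => _.
    apply: (@holomorphic_atI K (W2 K) (sum_manifold (affine K 2) (affine K 1)) _ _
      (W2_V K) (inr tt) trivial_coord) => t; last by move=> /V[t0 _]; rewrite fV.
    by apply: differentiable_row_nth => -[[|//] ?]; exact: dcoord.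
  apply: (@holomorphic_atI K (W2 K) (sum_manifold (affine K 2) (affine K 1)) _ _
    (W2_U K) (inl tt) drop0_row) => t; first exact: differentiable_drop0.
  by rewrite fU.
- apply: (@holomorphic_atI K (sum_manifold (affine K 2) (affine K 1)) (W2 K) _ _
    (inl tt) (W2_U K) cons0_row) => // t; exact: differentiable_cons0.
- apply: (@holomorphic_atI K (sum_manifold (affine K 2) (affine K 1)) (W2 K) _ _
    (inr tt) (W2_V K) axis) => // t.
  apply: differentiable_row_nth => -[[|[|[|//]]] ?] /=;
  [exact: differentiable_cst|exact: dcst|exact: dcoord].
Qed.
End Loci.

Theorem lemma4p3 (R : realType) (e1 e2 e3 e4 : poisson_structure (W2 R[i]))
    (he1 : forall x, biv e1 (W2_U R[i]) x = e1_U x)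
    (he2 : forall x, biv e2 (W2_U R[i]) x = e2_U x)
    (he3 : forall x, biv e3 (W2_U R[i]) x = e3_U x)
    (he4 : forall x, biv e4 (W2_U R[i]) x = e4_U x) :
  [/\ biholomorphic (degeneracy_locus e1) [set: affine R[i] 2%N],
      biholomorphic (degeneracy_locus e2)
        [set: prod_manifold (P1 R[i]) (affine R[i] 1%N)],
      biholomorphic (degeneracy_locus e3)
        [set: sum_manifold (affine R[i] 2%N) (affine R[i] 1%N)] &
      degeneracy_locus e4 = set0].
Proof.
split; [exact: locus_e1|exact: locus_e2|exact: locus_e3|exact: degeneracy_e4].
Qed.
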